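(* Let $n\in\mathbb{N}$ and, for $1\le j\le n$, let $0<c_{j}<1$, $k_{j}>0$ and $q_{j}=e^{-2k_{j}^{2}}$. Then the function \[ H(x)=\prod_{j=1}^{n}e^{-x^{2}}\left(-c_{j}e^{-k_{j}^{2}-2xk_{j}},-c_{j}e^{-k_{j}^{2}+2xk_{j}};q_{j}\right)_{\infty},\qquad x\in\mathbb{R}, \] is positive definite. Furthermore, for all $m\in\mathbb{N}$ and $x_{1},\dots,x_{m}\in\mathbb{R}$ the matrices \[ \left(\prod_{j=1}^{n}e^{-(x_{r}-x_{s})^{2}}\left(-c_{j}e^{-k_{j}^{2}-2(x_{r}-x_{s})k_{j}},-c_{j}e^{-k_{j}^{2}-2(x_{s}-x_{r})k_{j}};q_{j}\right)_{\infty}\right)_{r,s=1}^{m} \] are positive semidefinite, and for $k>0$, $q=e^{-2k^{2}}$ and $0<c<q^{1/2}$ we have \[ \left(-ce^{-2xk},-ce^{2xk};q\right)_{\infty}\le e^{x^{2}}\left(-c,-c;q\right)_{\infty},\qquad x\in\mathbb{R}. \]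
   Context: For $0<q<1$ and $a\in\mathbb{C}$, $(a;q)_{\infty}=\prod_{k=0}^{\infty}(1-aq^{k})$ and $(a_1,\dots,a_r;q)_\infty=\prod_{s=1}^r(a_s;q)_\infty$. A continuous function $f:\mathbb{R}\to\mathbb{C}$ with $f(0)>0$ is called positive definite if for every $n\in\mathbb{N}$ and all $x_{1},\dots,x_{n}\in\mathbb{R}$ the matrix $(f(x_{j}-x_{k}))_{j,k=1}^{n}$ is positive semidefinite (equivalently, $f$ is the Fourier transform of a finite positive measure on $\mathbb{R}$). *)

(* Defs.v *)
From HB Require Import structures.
From mathcomp Require Import all_boot all_order all_algebra.
From mathcomp Require Import all_classical all_reals all_analysis.
From mathcomp Require Import complex.
Set Implicit Arguments. Unset Strict Implicit. Unset Printing Implicit Defensive.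
Import Order.TTheory GRing.Theory Num.Theory numFieldNormedType.Exports.
Local Open Scope ring_scope.

Definition qpoch (R : realType) (a q : R) : R :=
  limn (fun N : nat => \prod_(k < N) (1 - a * q ^+ k)).

Definition qpoch2 (R : realType) (a b q : R) : R := qpoch a q * qpoch b q.

(* positive semidefinite (Hermitian sense): for all complex vectors c,
   sum_{r,s} c_r conj(c_s) A_{r s} >= 0 (in particular real) *)
Definition psd_mx (R : realType) (m : nat) (A : 'M[R]_m) : Prop :=
  forall c : 'I_m -> R[i],
    0 <= \sum_(r < m) \sum_(s < m) c r * (c s)^* * ((A r s)%:C)%C.

Definition posdef (R : realType) (f : R -> R) : Prop :=
  continuous f /\ 0 < f 0 /\
  forall (m : nat) (x : 'I_m -> R), psd_mx (\matrix_(r < m, s < m) f (x r - x s)).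

(* Main.v *)
(** Write theta(x) = e^{-x^2} (-c e^{-k^2-2xk}, -c e^{-k^2+2xk}; q)_oo with
    q = e^{-2k^2}, and u_m = c^m / (q;q)_m.  Euler's expansion followed by the
    q-binomial theorem gives
      theta(x) = (c^2;q)_oo sum_{m,l >= 0} u_m u_l e^{-(x - (km - kl))^2}.
    Since (x_r - x_s) - (km - kl) = (x_r - km) - (x_s - kl), positive
    semidefiniteness of the Gaussian kernel passes to theta, and then to products
    by Schur.  The last inequality is theta(x) <= theta(0), with parameter
    c e^{k^2} in place of c. *)

Require Import Defs.
From HB Require Import structures.
From mathcomp Require Import all_boot all_order all_algebra.
From mathcomp Require Import all_classical all_reals all_analysis.
From mathcomp Require Import complex.
From mathcomp Require Import ring lra.
Set Implicit Arguments. Unset Strict Implicit. Unset Printing Implicit Defensive.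
Import Order.TTheory GRing.Theory Num.Theory numFieldNormedType.Exports.
Local Open Scope ring_scope.

(** * Positive semidefinite real kernels *)

(** Only real weights are tested and no symmetry is built in; [psd_mx_sym] recovers the Hermitian
    condition for symmetric kernels. *)
Definition psd_kernel (R : realType) (m : nat) (A : 'I_m -> 'I_m -> R) : Prop :=
  forall w : 'I_m -> R, 0 <= \sum_r \sum_s w r * w s * A r s.

(** With c = a + ib, the Hermitian form has real part S(a,a) + S(b,b) and imaginary part S(b,a) -
    S(a,b), which vanishes by symmetry. *)
Lemma psd_mx_sym (R : realType) (m : nat) (A : 'I_m -> 'I_m -> R) :
  (forall r s, A r s = A s r) -> psd_kernel A ->
  psd_mx (\matrix_(r < m, s < m) A r s).
Proof.
move=> Asym Apsd c.
pose S (u v : 'I_m -> R) := \sum_(r < m) \sum_(s < m) u r * v s * A r s.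
have Ssym u v : S u v = S v u.
  rewrite /S exchange_big; apply: eq_bigr => r _; apply: eq_bigr => s _ /=.
  by rewrite (Asym s r) (mulrC (u s)).
pose a r := complex.Re (c r); pose b r := complex.Im (c r).
suff -> : \sum_(r < m) \sum_(s < m)
      c r * (c s)^* * (((\matrix_(r < m, s < m) A r s) r s)%:C)%C
     = (S a a + S b b)%:C%C + 'i%C * (S b a - S a b)%:C%C.
  by rewrite (Ssym a b) subrr mulr0 addr0 lecR addr_ge0 ?Apsd.
rewrite /S -!sumrB -!big_split /= !rmorph_sum mulr_sumr -big_split /=.
apply: eq_bigr => r _.
rewrite -!sumrB -!big_split /= !rmorph_sum mulr_sumr -big_split /=.
apply: eq_bigr => s _; rewrite mxE /a /b.
case: (c r) => x y; case: (c s) => z t.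
by rewrite /Num.conj /=; apply/eqP; rewrite eq_complex /=; apply/andP; split; apply/eqP; ring.
Qed.

Lemma cvg_sum (R : realType) (I : Type) (r : seq I) (f : I -> nat -> R) (l : I -> R) :
  (forall i, f i n @[n --> \oo] --> l i)%classic ->
  (\sum_(i <- r) f i n @[n --> \oo] --> \sum_(i <- r) l i)%classic.
Proof. by move=> fl; apply: cvg_big => // x; exact: add_continuous. Qed.

Lemma psd_kernel_cvg (R : realType) (m : nat) (A : nat -> 'I_m -> 'I_m -> R)
    (L : 'I_m -> 'I_m -> R) :
  (forall n, psd_kernel (A n)) ->
  (forall r s, (A n r s @[n --> \oo] --> L r s)%classic) -> psd_kernel L.
Proof.
move=> Apsd AL w.
have cv : (\sum_r \sum_s w r * w s * A n r s @[n --> \oo] -->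
    \sum_r \sum_s w r * w s * L r s)%classic.
  by apply: cvg_sum => r; apply: cvg_sum => s; apply: cvgMr; exact: AL.
rewrite -(cvg_lim _ cv) //; apply: limr_ge; first by apply/cvg_ex; eexists; exact: cv.
by apply: nearW => n; exact: Apsd.
Qed.

(* By the Schur product theorem this is the same as [psd_kernel A]; stated this
   way, stability under products is trivial, and it is only ever needed for
   limits of sums of rank-one kernels. *)
Definition schur_psd (R : realType) (m : nat) (A : 'I_m -> 'I_m -> R) : Prop :=
  forall B, psd_kernel B -> psd_kernel (fun r s => A r s * B r s).

(** * Closure properties of Schur multipliers, and the Gaussian kernel *)

Section SchurPsd.
Variables (R : realType) (m : nat).
Implicit Types (A B : 'I_m -> 'I_m -> R) (v : 'I_m -> R).

Lemma schur_psd_ext A B : (forall r s, A r s = B r s) -> schur_psd A -> schur_psd B.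
Proof.
move=> AB hA C hC w; have := hA C hC w.
by under eq_bigr do under eq_bigr do rewrite AB.
Qed.

(** The factors [v r] and [v s] are absorbed into the weights. *)
Lemma schur_psd_rank1 v : schur_psd (fun r s => v r * v s).
Proof.
move=> B hB w; have := hB (fun r => w r * v r); congr (0 <= _).
by apply: eq_bigr => r _; apply: eq_bigr => s _; ring.
Qed.

Lemma schur_psd1 : schur_psd (fun _ _ : 'I_m => 1 : R).
Proof. by apply: schur_psd_ext (schur_psd_rank1 (fun=> 1)) => r s; rewrite mulr1. Qed.

Lemma schur_psdM A B : schur_psd A -> schur_psd B ->
  schur_psd (fun r s => A r s * B r s).
Proof.
move=> hA hB C hC w; have := hA _ (hB _ hC) w.
by under eq_bigr do under eq_bigr do rewrite (mulrA (A _ _)).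
Qed.

Lemma schur_psd_prod (I : Type) (l : seq I) (A : I -> 'I_m -> 'I_m -> R) :
  (forall i, schur_psd (A i)) -> schur_psd (fun r s => \prod_(i <- l) A i r s).
Proof.
move=> hA; elim: l => [|i l IHl].
  by apply: schur_psd_ext schur_psd1 => r s; rewrite big_nil.
by apply: schur_psd_ext (schur_psdM (hA i) IHl) => r s; rewrite big_cons.
Qed.

Lemma schur_psd_sum (I : Type) (l : seq I) (A : I -> 'I_m -> 'I_m -> R) :
  (forall i, schur_psd (A i)) -> schur_psd (fun r s => \sum_(i <- l) A i r s).
Proof.
move=> hA B hB w.
rewrite (_ : \sum_r _ =
    \sum_(i <- l) \sum_r \sum_s w r * w s * (A i r s * B r s)).
  by apply: sumr_ge0 => i _; exact: hA.
rewrite [RHS]exchange_big; apply: eq_bigr => r _ /=.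
rewrite [RHS]exchange_big; apply: eq_bigr => s _ /=.
by rewrite mulr_suml mulr_sumr.
Qed.

Lemma schur_psdZ (a : R) A : 0 <= a -> schur_psd A -> schur_psd (fun r s => a * A r s).
Proof.
move=> a0 hA B hB w.
rewrite (_ : \sum_r _ = a * \sum_r \sum_s w r * w s * (A r s * B r s)).
  by rewrite mulr_ge0 // hA.
rewrite mulr_sumr; apply: eq_bigr => r _; rewrite mulr_sumr; apply: eq_bigr => s _.
by ring.
Qed.

Lemma schur_psd_cvg (A : nat -> 'I_m -> 'I_m -> R) B :
  (forall n, schur_psd (A n)) ->
  (forall r s, (A n r s @[n --> \oo] --> B r s)%classic) -> schur_psd B.
Proof.
move=> hA AB C hC; apply: (@psd_kernel_cvg _ _ (fun n r s => A n r s * C r s)).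
  by move=> n; exact: hA.
by move=> r s; apply: cvgMl; exact: AB.
Qed.

(** Multiply the constant kernel 1, whose quadratic form is the square of the sum of the weights. *)
Lemma schur_psd_psd A : schur_psd A -> psd_kernel A.
Proof.
move=> hA w; have h1 : psd_kernel (fun _ _ : 'I_m => 1 : R).
  move=> u; under eq_bigr do under eq_bigr do rewrite mulr1.
  by under eq_bigr do rewrite -mulr_sumr; rewrite -mulr_suml -expr2 sqr_ge0.
by have := hA _ h1 w; under eq_bigr do under eq_bigr do rewrite mulr1.
Qed.

(* Expanding [expR (2 * a * b)] in [expR (- (a - b) ^+ 2) =
   expR (- a ^+ 2) * expR (- b ^+ 2) * expR (2 * a * b)] writes the Gaussian as a
   limit of sums of rank-one kernels, and this survives the double sum. *)
Lemma schur_psd_gauss (N : nat) (u y : nat -> R) v :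
  schur_psd (fun r s => \sum_(i < N) \sum_(j < N)
    u i * u j * expR (- ((v r - y i) - (v s - y j)) ^+ 2)).
Proof.
(* In degree n the Taylor term 2^n/n! (v r - y i)^n (v s - y j)^n splits into a factor in r, i and a
   factor in s, j, so the sum over i and j collapses to a multiple of [g n r * g n s]. *)
pose g n r := \sum_(i < N) u i * (expR (- (v r - y i) ^+ 2) * (v r - y i) ^+ n).
apply: (@schur_psd_cvg
  (fun J r s => \sum_(n < J) (2 ^+ n / n`!%:R) * (g n r * g n s))).
  move=> J; apply: schur_psd_sum => n; apply: schur_psdZ.
    by rewrite divr_ge0 ?exprn_ge0 ?ler0n.
  exact: schur_psd_rank1.
move=> r s.
rewrite (_ : (fun J : nat => _) = (fun J : nat => \sum_(i < N) \sum_(j < N)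
    u i * u j * (expR (- (v r - y i) ^+ 2) * expR (- (v s - y j) ^+ 2) *
      series (exp_coeff (2 * (v r - y i) * (v s - y j))) J))).
  apply: cvg_sum => i; apply: cvg_sum => j; apply: cvgMr.
  rewrite (_ : - (v r - y i - (v s - y j)) ^+ 2 = - (v r - y i) ^+ 2 + - (v s - y j) ^+ 2 +
    2 * (v r - y i) * (v s - y j)); last by ring.
  rewrite !expRD; apply: cvgMr.
  exact: is_cvg_series_exp_coeff.
apply/funext => J; rewrite /g.
transitivity (\sum_(n < J) \sum_(i < N) \sum_(j < N) 2 ^+ n / n`!%:R *
    (u i * (expR (- (v r - y i) ^+ 2) * (v r - y i) ^+ n) *
    (u j * (expR (- (v s - y j) ^+ 2) * (v s - y j) ^+ n)))).
  apply: eq_bigr => n _; rewrite mulr_suml mulr_sumr; apply: eq_bigr => i _.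
  by rewrite !mulr_sumr.
rewrite exchange_big; apply: eq_bigr => i _ /=.
rewrite exchange_big; apply: eq_bigr => j _ /=.
rewrite seriesEord /= !mulr_sumr; apply: eq_bigr => n _.
rewrite exp_coeffE /= !exprMn; move: (2 ^+ n) (n`!%:R^-1) => p f; ring.
Qed.

End SchurPsd.

(** * Limits of real sequences and of nonnegative double series *)

Lemma cvgn_ler (R : realType) (u v : nat -> R) (l l' : R) :
  (u n @[n --> \oo] --> l)%classic -> (v n @[n --> \oo] --> l')%classic ->
  (forall n, u n <= v n) -> l <= l'.
Proof. by move=> ul vl uv; apply: (ler_cvg_to ul vl); exact: nearW. Qed.

Lemma cvgn_ge (R : realType) (u : nat -> R) (l a : R) :
  (u n @[n --> \oo] --> l)%classic -> (forall n, a <= u n) -> a <= l.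
Proof. by apply: cvgn_ler; exact: cvg_cst. Qed.

(** The square sums increase and are bounded by S. Conversely, the first M rows cut at n >= M lie
    below the n-th square sum; letting n and then M tend to infinity gives S as a lower bound for
    the limit. *)
Lemma cvg_square_sum (R : realType) (T : nat -> nat -> R) (row : nat -> R) (S : R) :
  (forall m l, 0 <= T m l) ->
  (forall m, (\sum_(l < n) T m l @[n --> \oo] --> row m)%classic) ->
  (\sum_(m < n) row m @[n --> \oo] --> S)%classic ->
  (\sum_(m < n) \sum_(l < n) T m l @[n --> \oo] --> S)%classic.
Proof.
move=> T0 Trow rowS.
have homo_sum (f : nat -> R) : (forall i, 0 <= f i) ->
    {homo (fun n => \sum_(i < n) f i) : n m / (n <= m)%N >-> n <= m}.
  move=> f0; apply/nondecreasing_seqP => n.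
  by rewrite big_ord_recr /= lerDl.
have row_ge m n : \sum_(l < n) T m l <= row m.
  rewrite -(cvg_lim _ (Trow m)) //.
  apply: (nondecreasing_cvgn_le (homo_sum _ (T0 m))).
  by apply/cvg_ex; eexists; exact: Trow.
have row0 m : 0 <= row m by have := row_ge m 0; rewrite big_ord0.
have rowle n : \sum_(m < n) row m <= S.
  rewrite -(cvg_lim _ rowS) //; apply: (nondecreasing_cvgn_le (homo_sum _ row0)).
  by apply/cvg_ex; eexists; exact: rowS.
pose Q n := \sum_(m < n) \sum_(l < n) T m l.
have Q_le n : Q n <= S by apply: le_trans (rowle n); apply: ler_sum.
have Q_homo : {homo Q : n m / (n <= m)%N >-> n <= m}.
  move=> n m nm; apply: (@le_trans _ _ (\sum_(i < n) \sum_(l < m) T i l)).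
    by apply: ler_sum => i _; exact: homo_sum.
  by apply: (homo_sum (fun i => \sum_(l < m) T i l)) => // i; exact: sumr_ge0.
have cQ : cvgn Q by apply: nondecreasing_is_cvgn => //; exists S => _ [n _ <-].
suff -> : S = limn Q by exact: cQ.
apply/eqP; rewrite eq_le; apply/andP; split; last first.
  by apply: limr_le => //; exact: nearW.
rewrite -(cvg_lim _ rowS) //; apply: limr_le; first by apply/cvg_ex; eexists; exact: rowS.
apply: nearW => M.
have cM : (\sum_(m < M) \sum_(l < n) T m l @[n --> \oo] --> \sum_(m < M) row m)%classic.
  by apply: cvg_sum => m; exact: Trow.
apply: (ler_cvg_to cM cQ); near=> n.
apply: (homo_sum (fun i => \sum_(l < n) T i l)) => [i|]; first exact: sumr_ge0.
near: n; exact: nbhs_infty_ge.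
Unshelve. all: by end_near.
Qed.

(** * Infinite q-products: convergence, bounds and continuity *)

Section QProducts.
Variables (R : realType) (q : R).
Hypotheses (q_gt0 : 0 < q) (q_lt1 : q < 1).

Lemma qprod_ge1 (y : R) N : 0 <= y -> 1 <= \prod_(i < N) (1 + y * q ^+ i).
Proof.
move=> y0; elim: N => [|N IHN]; first by rewrite big_ord0.
by rewrite big_ord_recr /= mulr_ege1 // lerDl mulr_ge0 ?exprn_ge0 // ltW.
Qed.

Lemma qprod_le_expR (y : R) N : 0 <= y ->
  \prod_(i < N) expR (y * q ^+ i) <= expR (y / (1 - q)).
Proof.
move=> y0; rewrite -expR_sum ler_expR -mulr_sumr ler_wpM2l //.
have := @geometric_le_lim R N 1 q ler01 q_gt0.
rewrite (ger0_norm (ltW q_gt0)) => /(_ q_lt1).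
rewrite seriesEord div1r; congr (_ <= _).
by apply: eq_bigr => i _; rewrite /= mul1r.
Qed.

Lemma qprod_le (y : R) N : 0 <= y ->
  \prod_(i < N) (1 + y * q ^+ i) <= expR (y / (1 - q)).
Proof.
move=> y0; apply: le_trans (qprod_le_expR N y0); apply: ler_prod => i _.
by rewrite expR_ge1Dx addr_ge0 // mulr_ge0 ?exprn_ge0 // ltW.
Qed.

(** [qpoch] is a bare [limn], informative only once convergence is known. Here the partial products
    increase and are bounded by comparing each factor with an exponential and summing a geometric
    series. *)
Lemma cvg_qpochN (y : R) : 0 <= y ->
  (\prod_(i < N) (1 + y * q ^+ i) @[N --> \oo] --> qpoch (- y) q)%classic.
Proof.
move=> y0.
rewrite /qpoch (_ : (fun N => \prod_(i < N) (1 - - y * q ^+ i)) =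
    (fun N => \prod_(i < N) (1 + y * q ^+ i))); last first.
  by apply/funext => N; apply: eq_bigr => i _; rewrite mulNr opprK.
apply: nondecreasing_is_cvgn.
  apply/nondecreasing_seqP => N; rewrite big_ord_recr /= ler_peMr //.
    by rewrite (le_trans ler01) ?qprod_ge1.
  by rewrite lerDl mulr_ge0 ?exprn_ge0 // ltW.
by exists (expR (y / (1 - q))) => _ [N _ <-]; exact: qprod_le.
Qed.

Lemma cvg_qpoch (a : R) : 0 <= a <= 1 ->
  (\prod_(i < N) (1 - a * q ^+ i) @[N --> \oo] --> qpoch a q)%classic.
Proof.
move=> /andP[a0 a1].
have qi i : 0 <= a * q ^+ i <= 1.
  by rewrite mulr_ge0 ?mulr_ile1 ?exprn_ge0 ?exprn_ile1 // ltW.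
have p0 N : 0 <= \prod_(i < N) (1 - a * q ^+ i).
  by apply: prodr_ge0 => i _; rewrite subr_ge0; case/andP: (qi i).
apply: nonincreasing_is_cvgn.
  apply/nonincreasing_seqP => N; rewrite big_ord_recr /= ler_piMr ?p0 //.
  by rewrite gerBl; case/andP: (qi N).
by exists 0 => _ [N _ <-].
Qed.

Lemma qpoch_ge0 (a : R) : 0 <= a <= 1 -> 0 <= qpoch a q.
Proof.
move=> a01; apply: (cvgn_ge (cvg_qpoch a01)) => N; apply: prodr_ge0 => i _; case/andP: a01 => a0 a1.
by rewrite subr_ge0 mulr_ile1 ?exprn_ge0 ?exprn_ile1 // ltW.
Qed.

Lemma qpochN_ge1 (y : R) : 0 <= y -> 1 <= qpoch (- y) q.
Proof.
by move=> y0; apply: (cvgn_ge (cvg_qpochN y0)) => N; exact: qprod_ge1.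
Qed.

Lemma qpoch0 : qpoch 0 q = 1.
Proof.
rewrite /qpoch (_ : (fun N => _) = fun=> 1) ?lim_cst //.
by apply/funext => N; apply: big1 => i _; rewrite mul0r subr0.
Qed.

Lemma qpochNS (y : R) : 0 <= y -> qpoch (- y) q = (1 + y) * qpoch (- (y * q)) q.
Proof.
move=> y0; have yq0 : 0 <= y * q by rewrite mulr_ge0 // ltW.
rewrite -(cvg_lim _ (cvg_qpochN y0)) //; apply: cvg_lim => //.
rewrite -cvg_shiftS /=.
rewrite (_ : (fun N => _) =
    (fun N => (1 + y) * \prod_(i < N) (1 + y * q * q ^+ i))).
  by apply: cvgMr; exact: cvg_qpochN.
apply/funext => N; rewrite big_ord_recl expr0 mulr1; congr (_ * _).
by apply: eq_bigr => i _; rewrite exprS mulrA.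
Qed.

(** A multiplicative Lipschitz bound, proved factor by factor: with t = q^i, 1 + yt <= (1 + zt)(1 +
    |y - z|t) <= (1 + zt) e^{|y - z|t}. It yields continuity without uniform convergence. *)
Lemma qpochN_le (y z : R) : 0 <= y -> 0 <= z ->
  qpoch (- y) q <= qpoch (- z) q * expR (`|y - z| / (1 - q)).
Proof.
move=> y0 z0; apply: (cvgn_ler (cvg_qpochN y0)
  (cvgMl (b := expR (`|y - z| / (1 - q))) (cvg_qpochN z0))) => N.
apply: (@le_trans _ _ (\prod_(i < N) (1 + z * q ^+ i) *
    \prod_(i < N) expR (`|y - z| * q ^+ i))); last first.
  rewrite ler_wpM2l ?qprod_le_expR //.
  by rewrite (le_trans ler01) ?qprod_ge1.
rewrite -big_split /=; apply: ler_prod => i _.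
have qi : 0 <= q ^+ i by rewrite exprn_ge0 // ltW.
rewrite addr_ge0 ?mulr_ge0 //=.
apply: (@le_trans _ _ ((1 + z * q ^+ i) * (1 + `|y - z| * q ^+ i))); last first.
  by rewrite ler_wpM2l ?expR_ge1Dx // addr_ge0 ?mulr_ge0.
have := ler_norm (y - z); set d := `|_| => yzd.
have d0 : 0 <= d by exact: normr_ge0.
(* The two sides of the goal differ by exactly the sum of the products in [h1] and [h2]. *)
have h1 : 0 <= q ^+ i * (d - (y - z)) by rewrite mulr_ge0 // subr_ge0.
have h2 : 0 <= z * q ^+ i * (d * q ^+ i) by rewrite !mulr_ge0.
lra.
Qed.

Lemma continuous_qpochN (g : R -> R) : continuous g -> (forall x, 0 <= g x) ->
  continuous (fun x => qpoch (- g x) q).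
Proof.
move=> cg g0 x.
pose e (t : R) := expR (`|g t - g x| / (1 - q)).
have ce : (e t @[t --> x] --> (1 : R))%classic.
  rewrite (_ : 1 = e x); last by rewrite /e subrr normr0 mul0r expR0.
  apply: (@continuous_comp _ _ _ (fun t => `|g t - g x| / (1 - q)) expR);
    last exact: continuous_expR.
  apply: cvgMl; apply: cvg_norm; apply: cvgB; [exact: cg|exact: cvg_cst].
(* Applying [qpochN_le] in both directions traps the value at t between the value at x divided by
   [e t] and multiplied by [e t]. *)
apply: (squeeze_cvgr (f := fun t => qpoch (- g x) q / e t)
  (h := fun t => qpoch (- g x) q * e t)).
- apply: nearW => t; rewrite qpochN_le // andbT ler_pdivrMr ?expR_gt0 //.
  by rewrite /e distrC qpochN_le.
- rewrite -[X in (_ --> X)%classic]divr1; apply: cvgMr.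
  exact: (cvgV (oner_neq0 R) ce).
- by rewrite -[X in (_ --> X)%classic]mulr1; apply: cvgMr.
Qed.

(** * The q-binomial series *)

(** For nonzero a this is a^m (-b/a; q)_m / (q; q)_m. The homogeneous form also covers a = 0, where
    it is Euler's coefficient b^m q^{m(m-1)/2} / (q; q)_m. *)
Definition qcoef (a b : R) m : R :=
  \prod_(i < m) ((a + b * q ^+ i) / (1 - q ^+ i.+1)).

Definition qbin_sum (a b x : R) M : R := \sum_(m < M) qcoef a b m * x ^+ m.

Lemma onemX_gt0 m : 0 < 1 - q ^+ m.+1.
Proof. by rewrite subr_gt0 exprn_ilt1 // ltW. Qed.

Lemma qcoefS a b m : qcoef a b m.+1 = qcoef a b m * ((a + b * q ^+ m) / (1 - q ^+ m.+1)).
Proof. by rewrite /qcoef big_ord_recr. Qed.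

(** Comparing coefficients reduces this to [qcoefS] with its denominator cleared. The lengths M+1
    and M are matched so that truncation leaves no remainder. *)
Lemma qbin_sum_rec a b x M :
  qbin_sum a b x M.+1 - a * x * qbin_sum a b x M =
  qbin_sum a b (x * q) M.+1 + b * x * qbin_sum a b (x * q) M.
Proof.
elim: M => [|M IHM]; first by rewrite /qbin_sum !big_ord1 !big_ord0 !expr0; ring.
have E : qcoef a b M.+1 * (1 - q ^+ M.+1) = qcoef a b M * (a + b * q ^+ M).
  by rewrite qcoefS -mulrA divfK // gt_eqF ?onemX_gt0.
have SM y n : qbin_sum a b y n.+1 = qbin_sum a b y n + qcoef a b n * y ^+ n.
  by rewrite /qbin_sum big_ord_recr.
transitivity ((qbin_sum a b x M.+1 - a * x * qbin_sum a b x M) +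
   (qcoef a b M.+1 * (1 - q ^+ M.+1) * x ^+ M.+1 - a * x * qcoef a b M * x ^+ M +
    qcoef a b M.+1 * q ^+ M.+1 * x ^+ M.+1)).
  by rewrite (SM x M.+1) (SM x M); ring.
rewrite IHM E (SM (x * q) M.+1) (SM (x * q) M) !exprMn !exprS; ring.
Qed.

Section NonNeg.
Variables (a b : R).
Hypotheses (a0 : 0 <= a) (b0 : 0 <= b).

Lemma qcoef_ge0 m : 0 <= qcoef a b m.
Proof.
apply: prodr_ge0 => i _.
apply: divr_ge0; last exact: ltW (onemX_gt0 _).
by rewrite addr_ge0 ?mulr_ge0 ?exprn_ge0 ?(ltW q_gt0).
Qed.

Lemma qbin_sum_homo x : 0 <= x ->
  {homo qbin_sum a b x : n m / (n <= m)%N >-> n <= m}.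
Proof.
move=> x0; apply/nondecreasing_seqP => M; rewrite /qbin_sum big_ord_recr /=.
by rewrite lerDl mulr_ge0 ?qcoef_ge0 ?exprn_ge0.
Qed.

Lemma qbin_sum_ge1 x M : 0 <= x -> 1 <= qbin_sum a b x M.+1.
Proof.
move=> x0; apply: le_trans (qbin_sum_homo x0 (ltn0Sn M)).
by rewrite /qbin_sum big_ord1 /qcoef big_ord0 mul1r.
Qed.

(** Every term of positive degree shrinks at least by the factor s. With s = q^N this forces the
    series at x q^N towards 1. *)
Lemma qbin_sum_scale s x M : 0 <= s <= 1 -> 0 <= x ->
  qbin_sum a b (x * s) M.+1 <= 1 + s * (qbin_sum a b x M.+1 - 1).
Proof.
move=> /andP[s0 s1] x0; rewrite /qbin_sum !big_ord_recl /= {1 3}/qcoef big_ord0.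
rewrite !expr0 !mulr1 addrAC subrr add0r lerD2l mulr_sumr; apply: ler_sum => i _.
rewrite exprMn [leRHS]mulrCA ler_wpM2l ?qcoef_ge0 //.
rewrite mulrC ler_wpM2r ?exprn_ge0 //= /bump exprS.
by rewrite ler_piMr // exprn_ile1.
Qed.

(** A bound uniform in M, from which convergence follows by monotonicity. The recurrence gives F(t)
    <= e^{Ct} F(tq) on [0, x]; iterating along t = x q^i, the exponents sum to at most Cx/(1 - q)
    while F(x q^N) tends to 1. *)
Lemma qbin_sum_le x M : 0 <= x -> a * x < 1 ->
  qbin_sum a b x M <= expR ((b + a / (1 - a * x)) * (x / (1 - q))).
Proof.
move=> x0 ax1; set C := b + _.
have C0 : 0 <= C by rewrite addr_ge0 ?divr_ge0 // subr_ge0 ltW.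
apply: le_trans (qbin_sum_homo x0 (leqnSn M)) _.
pose F t := qbin_sum a b t M.+1; rewrite -/(F x).
have step t : 0 <= t <= x -> F t <= expR (C * t) * F (t * q).
  move=> /andP[t0 tx].
  have at1 : a * t < 1 by apply: le_lt_trans ax1; rewrite ler_wpM2l.
  have tq0 : 0 <= t * q by rewrite mulr_ge0 // ltW.
  (* Monotonicity in the length turns the exact recurrence, with its mixed lengths, into an
     inequality between sums of the same length M+1. *)
  have h : (1 - a * t) * F t <= (1 + b * t) * F (t * q).
    rewrite !mulrDl !mul1r mulNr.
    apply: (@le_trans _ _ (F t - a * t * qbin_sum a b t M)).
      by rewrite lerB // ler_wpM2l ?mulr_ge0 // qbin_sum_homo.
    by rewrite qbin_sum_rec lerD2l ler_wpM2l ?mulr_ge0 // qbin_sum_homo.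
  have F0 : 0 <= F (t * q) by rewrite (le_trans ler01) ?qbin_sum_ge1.
  (* For t <= x, 1/(1 - at) <= 1 + at/(1 - ax), which is linear in t and so lies below an
     exponential. *)
  apply: (@le_trans _ _ ((1 + a / (1 - a * x) * t) * ((1 + b * t) * F (t * q)))).
    have d0 : 0 < 1 - a * t by rewrite subr_gt0.
    have d1 : 0 < 1 - a * x by rewrite subr_gt0.
    apply: (@le_trans _ _ ((1 - a * t)^-1 * ((1 - a * t) * F t))).
      by rewrite mulKf // gt_eqF.
    apply: (@le_trans _ _ ((1 - a * t)^-1 * ((1 + b * t) * F (t * q)))).
      by rewrite ler_wpM2l // invr_ge0 ltW.
    rewrite ler_wpM2r //; first by rewrite mulr_ge0 // addr_ge0 // mulr_ge0.
    rewrite -div1r ler_pdivrMr //.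
    have -> : (1 + a / (1 - a * x) * t) * (1 - a * t) =
       1 + a * t * (a * x - a * t) / (1 - a * x) by field; rewrite gt_eqF.
    by rewrite lerDl divr_ge0 ?(ltW d1) ?mulr_ge0 // subr_ge0 ler_wpM2l.
  rewrite mulrA ler_wpM2r // mulrC /C [(b + _) * t]mulrDl expRD.
  have [b1 a1] := (expR_ge1Dx (b * t), expR_ge1Dx (a / (1 - a * x) * t)).
  have p1 : 0 <= 1 + b * t by rewrite addr_ge0 ?mulr_ge0.
  have p2 : 0 <= 1 + a / (1 - a * x) * t.
    by rewrite addr_ge0 // mulr_ge0 // divr_ge0 // subr_ge0 ltW.
  exact: ler_pM.
(* Since t/(1 - q) - tq/(1 - q) = t, this weight absorbs the factor e^{Ct}, and [step] becomes G(t)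
   <= G(tq). *)
pose G t := F t * expR (- (C * (t / (1 - q)))).
have Gstep N : G x <= G (x * q ^+ N).
  elim: N => [|N]; first by rewrite mulr1.
  move=> /le_trans; apply; set t := x * q ^+ N.
  have t0 : 0 <= t <= x.
    by rewrite mulr_ge0 ?ler_piMr ?exprn_ge0 ?exprn_ile1 // ltW.
  rewrite /G (_ : x * q ^+ N.+1 = t * q); last by rewrite exprSr mulrA.
  apply: le_trans (ler_wpM2r (expR_ge0 _) (step _ t0)) _.
  rewrite mulrAC -expRD mulrC (_ : C * t + _ = - (C * (t * q / (1 - q)))) //.
  by field; rewrite subr_eq0 gt_eqF.
have Gle N : G x <= 1 + q ^+ N * (F x - 1).
  apply: le_trans (Gstep N) _.
  have qN0 : 0 <= q ^+ N by rewrite exprn_ge0 // ltW.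
  apply: (@le_trans _ _ (F (x * q ^+ N))).
    have t0 : 0 <= x * q ^+ N by rewrite mulr_ge0.
    rewrite /G ler_piMr ?(le_trans ler01) ?qbin_sum_ge1 //.
    rewrite -[leRHS]expR0 ler_expR oppr_le0 mulr_ge0 // divr_ge0 //.
    by rewrite subr_ge0 ltW.
  by apply: qbin_sum_scale => //; rewrite qN0 exprn_ile1 // ltW.
have : G x <= 1.
  have cv : (1 + q ^+ N * (F x - 1) @[N --> \oo] --> 1 + 0 * (F x - 1))%classic.
    apply: cvgD; first exact: cvg_cst.
    by apply: cvgMl; apply: cvg_expr; rewrite ger0_norm // ltW.
  rewrite mul0r addr0 in cv.
  exact: (cvgn_ge cv).
by rewrite /G expRN ler_pdivrMr ?expR_gt0 // mul1r.
Qed.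

Lemma is_cvg_qbin_sum x : 0 <= x -> a * x < 1 -> cvgn (qbin_sum a b x).
Proof.
move=> x0 ax1; apply: nondecreasing_is_cvgn; first exact: qbin_sum_homo.
by exists (expR ((b + a / (1 - a * x)) * (x / (1 - q)))) => _ [M _ <-]; exact: qbin_sum_le.
Qed.

(* The q-binomial theorem; [a = 0] gives Euler's expansion of (-b x; q)_oo.
   The recurrence [qbin_sum_rec] becomes (1 - a x) F(x) = (1 + b x) F(q x). *)
Lemma qbinomial x : 0 <= x -> a * x < 1 ->
  limn (qbin_sum a b x) * qpoch (a * x) q = qpoch (- (b * x)) q.
Proof.
move=> x0 ax1; pose F t := limn (qbin_sum a b t).
have q0 := ltW q_gt0.
have FS t : 0 <= t -> a * t < 1 -> F t * (1 - a * t) = (1 + b * t) * F (t * q).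
  move=> t0 at1.
  have tq0 : 0 <= t * q by rewrite mulr_ge0.
  have atq1 : a * (t * q) < 1.
    by apply: le_lt_trans at1; rewrite ler_wpM2l // ler_piMr // ltW.
  have cl : (qbin_sum a b t M.+1 - a * t * qbin_sum a b t M @[M --> \oo] -->
      F t - a * t * F t)%classic.
    have cF := is_cvg_qbin_sum t0 at1.
    apply: cvgB; last by apply: cvgMr; exact: cF.
    by rewrite (cvg_shiftS (qbin_sum a b t)); exact: cF.
  have cr : (qbin_sum a b (t * q) M.+1 + b * t * qbin_sum a b (t * q) M @[M --> \oo] -->
      F (t * q) + b * t * F (t * q))%classic.
    have cF := is_cvg_qbin_sum tq0 atq1.
    apply: cvgD; last by apply: cvgMr; exact: cF.
    by rewrite (cvg_shiftS (qbin_sum a b (t * q))); exact: cF.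
  rewrite mulrBr mulr1 [F t * _]mulrC [RHS]mulrDl mul1r.
  rewrite (funext (fun M => qbin_sum_rec a b t M)) in cl.
  by rewrite -(cvg_lim _ cl) // -(cvg_lim _ cr).
have qN N : 0 <= q ^+ N <= 1 by rewrite exprn_ge0 ?exprn_ile1 // ltW.
(* [FS] is used at x q^i for i < N, with the factors kept on both sides to avoid division. *)
have FN N : F x * \prod_(i < N) (1 - a * x * q ^+ i) =
    \prod_(i < N) (1 + b * x * q ^+ i) * F (x * q ^+ N).
  elim: N => [|N IHN]; first by rewrite !big_ord0 !mulr1 mul1r.
  rewrite !big_ord_recr /= [LHS]mulrA IHN -mulrA -[a * x * _]mulrA.
  case/andP: (qN N) => qN0 qN1.
  have axN : a * (x * q ^+ N) < 1.
    by apply: le_lt_trans ax1; rewrite ler_wpM2l // ler_piMr.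
  by rewrite FS ?mulr_ge0 // exprSr; rewrite !mulrA.
(* Continuity of F at 0 along x q^N, by squeezing between 1 and the bound of [qbin_sum_scale]. *)
have F1 : (F (x * q ^+ N) @[N --> \oo] --> (1 : R))%classic.
  have cv : (1 + q ^+ N * (F x - 1) @[N --> \oo] --> 1 + 0 * (F x - 1))%classic.
    apply: cvgD; first exact: cvg_cst.
    by apply: cvgMl; apply: cvg_expr; rewrite ger0_norm // ltW.
  rewrite mul0r addr0 in cv.
  apply: (squeeze_cvgr (f := fun=> 1) _ _ cv); last exact: cvg_cst.
  apply: nearW => N.
  case/andP: (qN N) => qN0 qN1.
  have t0 : 0 <= x * q ^+ N by rewrite mulr_ge0.
  have ct : (qbin_sum a b (x * q ^+ N) M.+1 @[M --> \oo] --> F (x * q ^+ N))%classic.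
    have atq1 : a * (x * q ^+ N) < 1.
      by apply: le_lt_trans ax1; rewrite ler_wpM2l // ler_piMr.
    rewrite (cvg_shiftS (qbin_sum a b (x * q ^+ N))).
    exact: (is_cvg_qbin_sum t0 atq1).
  apply/andP; split.
    by apply: (cvgn_ge ct) => M; exact: qbin_sum_ge1.
  have cx : (1 + q ^+ N * (qbin_sum a b x M.+1 - 1) @[M --> \oo] -->
      1 + q ^+ N * (F x - 1))%classic.
    apply: cvgD; first exact: cvg_cst.
    apply: cvgMr; apply: cvgB; last by apply: cvg_cst.
    by rewrite (cvg_shiftS (qbin_sum a b x)); exact: (is_cvg_qbin_sum x0 ax1).
  by apply: (cvgn_ler ct cx) => M; exact: qbin_sum_scale.
have ax0 : 0 <= a * x by rewrite mulr_ge0.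
have ax01 : 0 <= a * x <= 1 by rewrite ax0 ltW.
have bx0 : 0 <= b * x by rewrite mulr_ge0.
have cl : (F x * \prod_(i < N) (1 - a * x * q ^+ i) @[N --> \oo] -->
    F x * qpoch (a * x) q)%classic by apply: cvgMr; exact: cvg_qpoch.
have cr : (\prod_(i < N) (1 + b * x * q ^+ i) * F (x * q ^+ N) @[N --> \oo] -->
    qpoch (- (b * x)) q * 1)%classic by apply: cvgM => //; exact: cvg_qpochN.
rewrite (funext FN) in cl.
by rewrite mulr1 in cr; rewrite -(cvg_lim _ cl) // -(cvg_lim _ cr).
Qed.

End NonNeg.
End QProducts.

(** * A single theta factor and its Gaussian expansion *)

Section Factor.
Variables (R : realType) (c k : R).
Hypotheses (c_gt0 : 0 < c) (c_lt1 : c < 1) (k_gt0 : 0 < k).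

Let q : R := expR (- 2 * k ^+ 2).

Lemma nome_gt0 : 0 < q. Proof. exact: expR_gt0. Qed.

Lemma nome_lt1 : q < 1.
Proof. by rewrite /q expR_lt1 mulNr oppr_lt0 mulr_gt0 // exprn_gt0. Qed.

Lemma nomeX m : q ^+ m = expR (m%:R * (- 2 * k ^+ 2)).
Proof. by rewrite expRM_natl. Qed.

Let u m : R := c ^+ m / \prod_(i < m) (1 - q ^+ i.+1).

Let uS m : u m.+1 = u m * (c / (1 - q ^+ m.+1)).
Proof. by rewrite /u exprSr big_ord_recr /= invfM mulrACA. Qed.

Let u_ge0 m : 0 <= u m.
Proof.
rewrite divr_ge0 ?exprn_ge0 ?(ltW c_gt0) // prodr_ge0 // => i _.
exact: ltW (onemX_gt0 nome_gt0 nome_lt1 _).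
Qed.

(** Expanding the square leaves e^{-k^2 l^2} = e^{-k^2 l} q^{l(l-1)/2}, whose last factor is the
    numerator of Euler's coefficient. With X = x - km, row m becomes Euler's series at [y m x]. *)
Lemma gauss_row (X : R) l : u l * expR (- (X + k * l%:R) ^+ 2) =
  expR (- X ^+ 2) * (qcoef q 0 1 l * (c * expR (- k ^+ 2 - 2 * k * X)) ^+ l).
Proof.
elim: l => [|l IHl].
  by rewrite /u /qcoef !big_ord0 mulr0 addr0 !expr0 divr1 !mul1r mulr1.
rewrite uS qcoefS add0r mul1r [(c * _) ^+ _]exprS.
rewrite (_ : - (X + k * l.+1%:R) ^+ 2 = - (X + k * l%:R) ^+ 2 +
    ((- k ^+ 2 - 2 * k * X) + l%:R * (- 2 * k ^+ 2))); last first.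
  by rewrite -natr1; ring.
rewrite expRD [expR (_ + l%:R * _)]expRD -nomeX.
transitivity (u l * expR (- (X + k * l%:R) ^+ 2) *
    (c / (1 - q ^+ l.+1) * (expR (- k ^+ 2 - 2 * k * X) * q ^+ l))).
  by ring.
by rewrite IHl; ring.
Qed.

Let y m x : R := c * expR (- k ^+ 2 - 2 * k * (x - k * m%:R)).

Let y_ge0 m x : 0 <= y m x.
Proof. by rewrite mulr_ge0 ?expR_ge0 // ltW. Qed.

(** Because y_m = q y_{m+1}, passing from row m to row m+1 adds one factor 1 + y_{m+1} to the
    q-product; combined with the Gaussian ratio it gives the next factor of a q-binomial
    coefficient. *)
Lemma gauss_col (x : R) m :
  u m * (expR (- (x - k * m%:R) ^+ 2) * qpoch (- y m x) q) =
  expR (- x ^+ 2) * qpoch (- y 0 x) q *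
    qcoef q (c ^+ 2) (c * expR (- k ^+ 2 + 2 * x * k)) m.
Proof.
elim: m => [|m IHm].
  by rewrite /u /qcoef !big_ord0 mulr0 subr0 expr0 divr1 mul1r mulr1.
have yS : y m x = y m.+1 x * q.
  rewrite /y -[RHS]mulrA -expRD -natr1; congr (_ * expR _); ring.
rewrite (qpochNS nome_gt0 nome_lt1) // -yS uS qcoefS.
(* The ratio of consecutive Gaussians. As [e * y m.+1 x = c], the new numerator c e (1 + y_{m+1})
   equals c^2 + c e, and c e = b q^m for the second parameter b of [qcoef]. *)
pose e := expR (2 * k * (x - k * m%:R) - k ^+ 2).
have -> : expR (- (x - k * m.+1%:R) ^+ 2) = expR (- (x - k * m%:R) ^+ 2) * e.
  by rewrite -expRD -natr1; congr expR; ring.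
have ey : e * y m.+1 x = c.
  rewrite /e /y mulrCA -expRD -[RHS]mulr1 -[in RHS]expR0 -natr1.
  by congr (_ * expR _); ring.
have ce : expR (- k ^+ 2 + 2 * x * k) * q ^+ m = e.
  by rewrite nomeX -expRD; congr expR; ring.
rewrite [RHS]mulrA -IHm -[c * expR _ * _]mulrA ce.
have -> : c ^+ 2 + c * e = c * e * (1 + y m.+1 x).
  by rewrite mulrDr mulr1 -mulrA ey addrC expr2.
by ring.
Qed.

Definition theta (x : R) : R :=
  expR (- x ^+ 2) * qpoch2 (- c * expR (- k ^+ 2 - 2 * x * k))
                           (- c * expR (- k ^+ 2 + 2 * x * k)) q.

(* Summing over l first is Euler's expansion, then summing over m is the
   q-binomial theorem with parameter c^2. *)
Lemma theta_expansion (x : R) :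
  (qpoch (c ^+ 2) q * \sum_(m < n) \sum_(l < n)
     u m * u l * expR (- (x - (k * m%:R - k * l%:R)) ^+ 2)
   @[n --> \oo] --> theta x)%classic.
Proof.
pose b := c * expR (- k ^+ 2 + 2 * x * k).
have b0 : 0 <= b by rewrite mulr_ge0 ?expR_ge0 // ltW.
have c2 : 0 <= c ^+ 2 by rewrite exprn_ge0 // ltW.
have c21 : c ^+ 2 * 1 < 1 by rewrite mulr1 exprn_ilt1 // ltW.
have [q0 q1] := (nome_gt0, nome_lt1).
have cB : (qbin_sum q (c ^+ 2) b 1 n @[n --> \oo] --> limn (qbin_sum q (c ^+ 2) b 1))%classic.
  exact: is_cvg_qbin_sum.
have qB := qbinomial q0 q1 c2 b0 ler01 c21.
rewrite !mulr1 in qB.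
(* The q-binomial theorem at the point 1 rewrites the product (-b; q)_oo in theta, which brings out
   the constant (c^2; q)_oo. *)
have -> : theta x = qpoch (c ^+ 2) q *
    (expR (- x ^+ 2) * qpoch (- y 0 x) q * limn (qbin_sum q (c ^+ 2) b 1)).
  rewrite /theta /qpoch2 !mulNr -/b -qB /y mulr0 subr0.
  rewrite (_ : 2 * x * k = 2 * k * x); last by ring.
  by ring.
apply: cvgMr; apply: (@cvg_square_sum R
  (fun m l => u m * u l * expR (- (x - (k * m%:R - k * l%:R)) ^+ 2))
  (fun m => u m * (expR (- (x - k * m%:R) ^+ 2) * qpoch (- y m x) q))).
- by move=> m l; rewrite mulr_ge0 ?expR_ge0 // mulr_ge0 ?u_ge0.
- move=> m.
  have E := qbinomial q0 q1 (lexx 0) ler01 (y_ge0 m x).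
  rewrite mul0r qpoch0 mulr1 mul1r in E.
  rewrite -(E ltr01).
  rewrite (_ : (fun n : nat => _) = fun n => u m * (expR (- (x - k * m%:R) ^+ 2) *
     qbin_sum q 0 1 (y m x) n)).
    apply: cvgMr; apply: cvgMr.
    by apply: is_cvg_qbin_sum => //; rewrite mul0r.
  apply/funext => n; rewrite /qbin_sum !mulr_sumr; apply: eq_bigr => l _.
  rewrite -gauss_row -mulrA; congr (_ * (_ * expR _)); ring.
- rewrite (_ : (fun n : nat => _) = fun n => expR (- x ^+ 2) * qpoch (- y 0 x) q *
     qbin_sum q (c ^+ 2) b 1 n).
    exact: cvgMr.
  apply/funext => n; rewrite /qbin_sum !mulr_sumr; apply: eq_bigr => m _.
  by rewrite gauss_col expr1n mulr1.
Qed.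

Lemma schur_psd_theta (m : nat) (x : 'I_m -> R) :
  schur_psd (fun r s => theta (x r - x s)).
Proof.
apply: (@schur_psd_cvg _ _ (fun n r s => qpoch (c ^+ 2) q *
  \sum_(i < n) \sum_(j < n)
     u i * u j * expR (- (x r - x s - (k * i%:R - k * j%:R)) ^+ 2))).
  move=> n; apply: schur_psdZ.
    apply: (qpoch_ge0 nome_gt0 nome_lt1).
    by rewrite exprn_ge0 ?exprn_ile1 // ltW.
  apply: schur_psd_ext (schur_psd_gauss n u (fun i => k * i%:R) x) => r s /=.
  apply: eq_bigr => i _; apply: eq_bigr => j _; congr (_ * expR _); ring.
by move=> r s; exact: theta_expansion.
Qed.

Lemma theta_gt0 (x : R) : 0 < theta x.
Proof.
have h (z : R) : 0 < qpoch (- c * expR z) q.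
  rewrite mulNr (lt_le_trans ltr01) // (qpochN_ge1 nome_gt0 nome_lt1) //.
  by rewrite mulr_ge0 ?expR_ge0 // ltW.
by rewrite /theta /qpoch2 !mulr_gt0 ?expR_gt0.
Qed.

Lemma thetaN (x : R) : theta (- x) = theta x.
Proof.
have e1 : - k ^+ 2 - 2 * - x * k = - k ^+ 2 + 2 * x * k by ring.
have e2 : - k ^+ 2 + 2 * - x * k = - k ^+ 2 - 2 * x * k by ring.
by rewrite /theta /qpoch2 sqrrN e1 e2 [X in _ * X]mulrC.
Qed.

Lemma continuous_theta : continuous theta.
Proof.
have cont_factor (f : R -> R) : continuous f ->
    continuous (fun x => qpoch (- c * expR (f x)) q).
  move=> cf; under eq_fun do rewrite mulNr.
  apply: (continuous_qpochN nome_gt0 nome_lt1 (g := fun x => c * expR (f x))).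
    move=> x; apply: cvgMr; apply: continuous_comp; first exact: cf.
    exact: continuous_expR.
  by move=> x; rewrite mulr_ge0 ?expR_ge0 // ltW.
have c2 : continuous (fun x : R => 2 * x * k).
  by move=> x; apply: cvgMl; apply: cvgMr; exact: cvg_id.
move=> x; apply: cvgM; last apply: cvgM.
- apply: (@continuous_comp _ _ _ (fun t : R => - t ^+ 2) expR);
    last exact: continuous_expR.
  by apply: cvgN; exact: exprn_continuous.
- apply: (cont_factor (fun x => - k ^+ 2 - 2 * x * k)) => t.
  by apply: cvgB; [exact: cvg_cst|exact: c2].
- apply: (cont_factor (fun x => - k ^+ 2 + 2 * x * k)) => t.
  by apply: cvgD; [exact: cvg_cst|exact: c2].
Qed.

(* Positive semidefiniteness at the two points x and 0. *)
Lemma theta_le0 (x : R) : theta x <= theta 0.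
Proof.
(* With weights 1 and -1 the form is 2 theta(0) - theta(x) - theta(-x), and theta is even. *)
have := schur_psd_psd (schur_psd_theta (fun i : 'I_2 => if i == 0 then x else 0))
  (fun i => if i == 0 then 1 else -1).
rewrite !big_ord_recr !big_ord0 /= !subrr subr0 sub0r thetaN.
lra.
Qed.

End Factor.

Theorem theorem2p6 (R : realType) :
  (forall (n : nat) (c k : 'I_n -> R),
     (forall j, 0 < c j < 1) -> (forall j, 0 < k j) ->
     let q := fun j => expR (- 2 * k j ^+ 2) in
     posdef (fun x : R => \prod_(j < n)
        (expR (- x ^+ 2) *
         qpoch2 (- c j * expR (- k j ^+ 2 - 2 * x * k j))
                (- c j * expR (- k j ^+ 2 + 2 * x * k j)) (q j)))
     /\
     (forall (m : nat) (x : 'I_m -> R),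
        psd_mx (\matrix_(r < m, s < m) \prod_(j < n)
          (expR (- (x r - x s) ^+ 2) *
           qpoch2 (- c j * expR (- k j ^+ 2 - 2 * (x r - x s) * k j))
                  (- c j * expR (- k j ^+ 2 - 2 * (x s - x r) * k j)) (q j)))))
  /\
  (forall (k c : R), 0 < k ->
     let q := expR (- 2 * k ^+ 2) in
     0 < c < Num.sqrt q ->
     forall x : R,
       qpoch2 (- c * expR (- 2 * x * k)) (- c * expR (2 * x * k)) q
       <= expR (x ^+ 2) * qpoch2 (- c) (- c) q).
Proof.
split=> [n c k c01 k0 q|k c k0 q /andP[c0 cq] x].
  have psd (m : nat) (x : 'I_m -> R) : psd_mx (\matrix_(r < m, s < m)
      \prod_(j < n) theta (c j) (k j) (x r - x s)).
    apply: psd_mx_sym => [r s|].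
      by apply: eq_bigr => j _; rewrite -thetaN opprB.
    apply: schur_psd_psd; apply: schur_psd_prod => j.
    by case/andP: (c01 j) => cj0 cj1; exact: schur_psd_theta.
  split; last first.
    move=> m x; rewrite (_ : matrix_of_fun _ _ = \matrix_(r < m, s < m)
        \prod_(j < n) theta (c j) (k j) (x r - x s)) //.
    apply/matrixP => r s; rewrite !mxE; apply: eq_bigr => j _.
    rewrite /theta (_ : - k j ^+ 2 + 2 * (x r - x s) * k j =
      - k j ^+ 2 - 2 * (x s - x r) * k j) //.
    by ring.
  split; last first.
    by split=> //; apply: prodr_gt0 => j _; case/andP: (c01 j) => *; exact: theta_gt0.
  move=> x; apply: (cvg_big (@mul_continuous R)) => j _.
  by case/andP: (c01 j) => cj0 _; exact: continuous_theta.
have sq : Num.sqrt q = expR (- k ^+ 2).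
  rewrite (_ : q = expR (- k ^+ 2) ^+ 2) ?sqrtr_sqr ?ger0_norm ?expR_ge0 //.
  by rewrite -expRM_natl /q; congr expR; ring.
(* [d] cancels the shift e^{-k^2} inside theta, and d < 1 is exactly c < e^{-k^2}, the square root
   of q. *)
pose d := c * expR (k ^+ 2).
have d0 : 0 < d by rewrite mulr_gt0 ?expR_gt0.
have d1 : d < 1.
  by rewrite /d -[k ^+ 2]opprK expRN ltr_pdivrMr ?expR_gt0 // mul1r -sq.
have dE z : - d * expR (- k ^+ 2 + z) = - c * expR z.
  rewrite /d !mulNr -mulrA -expRD; congr (- (_ * expR _)); ring.
have := theta_le0 d0 d1 k0 x.
rewrite /theta !dE /= -/q -ler_pdivlMl ?expR_gt0 // -expRN opprK.
have -> : - (2 * x * k) = - 2 * x * k by ring.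
rewrite !mulr0 !mul0r oppr0 !expr0n !oppr0 !expR0 !mulr1 mul1r.
by [].
Qed.
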